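(* NESTT-G can be written in the following compact form: with $\beta:=1/\sum_{i=1}^N\eta_i$, for every $r\ge1$, $$z^{r+1}=\arg\min_z\ h(z)+g_0(z)+\frac1{2\beta}\|z-u^{r+1}\|^2,$$ where $$u^{r+1}:=z^r-\beta\Big(\frac1{N\alpha_{i_r}}\big(\nabla g_{i_r}(z^r)-\nabla g_{i_r}(y_{i_r}^{r-1})\big)+\frac1N\sum_{i=1}^N\nabla g_i(y_i^{r-1})\Big).$$
   Context: Problem. $Z\subseteq\mathbb{R}^d$; $g_0,g_1,\dots,g_N:\mathbb{R}^d\to\mathbb{R}$ are smooth, possibly nonconvex; $p:\mathbb{R}^d\to\mathbb{R}$ is convex and lower semicontinuous, possibly nonsmooth. Put $g:=\frac1N\sum_{i=1}^N g_i$, $f:=g+g_0+p$, $h:=\iota_Z+p$ ($\iota_Z$ is the indicator function of $Z$). For $x=(x_1,\dots,x_N)$, $\lambda=(\lambda_1,\dots,\lambda_N)$ and penalty parameters $\eta_i>0$, the augmented Lagrangian is $$L(x,z;\lambda)=\sum_{i=1}^N\Big(\tfrac1N g_i(x_i)+\langle\lambda_i,x_i-z\rangle+\tfrac{\eta_i}{2}\|x_i-z\|^2\Big)+g_0(z)+h(z).$$ Standing assumptions. (A-a) $Z$ is closed and convex, and $\min_{z\in Z}f(z)>-\infty$. (A-b) $\|\nabla g_i(y)-\nabla g_i(z)\|\le L_i\|y-z\|$ for $i=0,\dots,N$, $\|\nabla g(y)-\nabla g(z)\|\le L\|y-z\|$ for all $y,z$, and $L_0\le\frac1N\sum_{i=1}^N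 L_i$. (A-c) $\eta_i>L_i/N$ for $i=1,\dots,N$; and if $g_0$ is nonconvex, $\sum_{i=1}^N\eta_i>3L_0$. NESTT-G. Given constants $\alpha_i>0$ and sampling probabilities $p_i$, let $V_i(x_i,z;\lambda_i)=\frac1N g_i(z)+\frac1N\langle\nabla g_i(z),x_i-z\rangle+\langle\lambda_i,x_i-z\rangle+\frac{\alpha_i\eta_i}{2}\|x_i-z\|^2$. Start from $z^1\in Z$, points $y_i^0\in\mathbb{R}^d$ and $\lambda_i^1=-\frac1N\nabla g_i(y_i^0)$. For $r=1,2,\dots$: pick $i_r\in\{1,\dots,N\}$ with probability $p_{i_r}$; set $x^{r+1}_{i_r}=\arg\min_{x_{i_r}}V_{i_r}(x_{i_r},z^r;\lambda^r_{i_r})$ and $\lambda^{r+1}_{i_r}=\lambda^r_{i_r}+\alpha_{i_r}\eta_{i_r}(x^{r+1}_{i_r}-z^r)$; for $j\ne i_r$ set $\lambda_j^{r+1}=\lambda_j^r$, $x_j^{r+1}=z^r$; then $z^{r+1}=\arg\min_{z\in Z}L(x^{r+1},z;\lambda^r)$. Memory points: for $r\ge1$, $y^r_{i_r}=z^r$, and $y^r_j=y^{r-1}_j$ for $j\neq i_r$ (so $y_j^r$ is the value of $z$ at the last iteration $\le r$ in which $j$ was picked). *)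

(* Defs.v *)
From HB Require Import structures.
From mathcomp Require Import all_boot all_order all_algebra.
From mathcomp Require Import all_classical all_reals all_analysis.

Set Implicit Arguments.
Unset Strict Implicit.
Unset Printing Implicit Defensive.

Import Order.TTheory GRing.Theory Num.Theory.
Import numFieldNormedType.Exports.

Local Open Scope classical_set_scope.
Local Open Scope ring_scope.

(* The library norm [`|u|] on ['rV[R]_d] is the sup norm, so the Euclidean
   structure is introduced separately. *)
Definition dotp (R : realType) (d : nat) (u v : 'rV[R]_d) : R :=
  \sum_(j < d) u 0 j * v 0 j.

Definition enorm (R : realType) (d : nat) (u : 'rV[R]_d) : R :=
  Num.sqrt (dotp u u).

(* The vector of partial derivatives; only meaningful as the gradient where
   [f] is differentiable. *)
Definition grad (R : realType) (d : nat) (f : 'rV[R]_d -> R) (x : 'rV[R]_d) :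
    'rV[R]_d :=
  \row_(j < d) 'D_(delta_mx 0 j) f x.

Definition lipschitz_grad (R : realType) (d : nat) (f : 'rV[R]_d -> R)
    (L : R) : Prop :=
  forall y z, enorm (grad f y - grad f z) <= L * enorm (y - z).

Definition argmin (X : Type) (disp : Order.disp_t) (O : porderType disp)
    (A : set X) (F : X -> O) : set X :=
  [set a | A a /\ forall b, A b -> (F a <= F b)%O].

Definition gmean (R : realType) (d N : nat) (g : 'I_N -> 'rV[R]_d -> R)
    (z : 'rV[R]_d) : R :=
  N%:R^-1 * \sum_(i < N) g i z.

Definition objective (R : realType) (d N : nat) (g : 'I_N -> 'rV[R]_d -> R)
    (g0 p : 'rV[R]_d -> R) (z : 'rV[R]_d) : R :=
  gmean g z + g0 z + p z.

Definition indicator (R : realType) (d : nat) (Z : set 'rV[R]_d)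
    (z : 'rV[R]_d) : \bar R :=
  (if z \in Z then 0 else +oo)%E.

Definition hfun (R : realType) (d : nat) (Z : set 'rV[R]_d)
    (p : 'rV[R]_d -> R) (z : 'rV[R]_d) : \bar R :=
  (indicator Z z + (p z)%:E)%E.

Definition augL (R : realType) (d N : nat) (Z : set 'rV[R]_d)
    (g : 'I_N -> 'rV[R]_d -> R) (g0 p : 'rV[R]_d -> R) (eta : 'I_N -> R)
    (x : 'I_N -> 'rV[R]_d) (z : 'rV[R]_d) (lambda : 'I_N -> 'rV[R]_d) :
    \bar R :=
  ((\sum_(i < N) (N%:R^-1 * g i (x i) + dotp (lambda i) (x i - z)
                  + eta i / 2 * enorm (x i - z) ^+ 2))%:E
   + (g0 z)%:E + hfun Z p z)%E.

Definition Vfun (R : realType) (d N : nat) (g : 'I_N -> 'rV[R]_d -> R)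
    (alpha eta : 'I_N -> R) (i : 'I_N) (xi z lambdai : 'rV[R]_d) : R :=
  N%:R^-1 * g i z + N%:R^-1 * dotp (grad (g i) z) (xi - z)
  + dotp lambdai (xi - z) + alpha i * eta i / 2 * enorm (xi - z) ^+ 2.

Record standing_assumptions (R : realType) (d N : nat) (Z : set 'rV[R]_d)
    (g : 'I_N -> 'rV[R]_d -> R) (g0 p : 'rV[R]_d -> R)
    (Lg : 'I_N -> R) (L0 L : R) (eta : 'I_N -> R) : Prop := {
  sa_g_diff : forall i x, differentiable (g i) x;
  sa_g0_diff : forall x, differentiable g0 x;
  sa_p_convex : convex_function [set: 'rV[R]_d] p;
  sa_p_lsc : lower_semicontinuous (fun x => (p x)%:E);
  sa_Z_closed : closed Z;
  sa_Z_convex : convex_set Z;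
  sa_f_bounded :
    (-oo < ereal_inf [set (objective g g0 p z)%:E | z in Z])%E;
  sa_g_lip : forall i, lipschitz_grad (g i) (Lg i);
  sa_g0_lip : lipschitz_grad g0 L0;
  sa_gmean_lip : lipschitz_grad (gmean g) L;
  sa_L0_le : L0 <= N%:R^-1 * \sum_(i < N) Lg i;
  sa_eta_gt0 : forall i, 0 < eta i;
  sa_eta_gt : forall i, Lg i / N%:R < eta i;
  sa_eta_sum : ~ convex_function [set: 'rV[R]_d] g0 ->
    3 * L0 < \sum_(i < N) eta i
}.

(* [idx r] for [1 <= r] is the [r]-th draw; the draws are independent with
   common law [prob], expressed through their joint law. *)
Record index_sampling (R : realType) (disp : measure_display)
    (Omega : measurableType disp) (P : probability Omega R) (N : nat)
    (prob : 'I_N -> R) (idx : nat -> Omega -> 'I_N) : Prop := {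
  is_prob_ge0 : forall k, 0 <= prob k;
  is_prob_sum : \sum_(k < N) prob k = 1;
  is_measurable : forall r k, (1 <= r)%N ->
    measurable [set w | idx r w = k];
  is_law : forall (n : nat) (k : nat -> 'I_N),
    P [set w | forall r, (1 <= r <= n)%N -> idx r w = k r]
    = (\prod_(1 <= r < n.+1) prob (k r))%:E
}.

(* One realisation of the algorithm together with its memory points.  [z], [x],
   [lambda] are indexed from 1 and [y] from 0, as in the recursion; other
   entries are unconstrained. *)
Record NESTT_G (R : realType) (d N : nat) (Z : set 'rV[R]_d)
    (g : 'I_N -> 'rV[R]_d -> R) (g0 p : 'rV[R]_d -> R)
    (alpha eta : 'I_N -> R)
    (z1 : 'rV[R]_d) (y0 : 'I_N -> 'rV[R]_d) (idx : nat -> 'I_N)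
    (x lambda y : nat -> 'I_N -> 'rV[R]_d) (z : nat -> 'rV[R]_d) : Prop := {
  ng_z1 : z 1%N = z1;
  ng_y0 : forall i, y 0%N i = y0 i;
  ng_lambda1 : forall i, lambda 1%N i = - (N%:R^-1 *: grad (g i) (y0 i));
  ng_x_pick : forall r, (1 <= r)%N ->
    argmin [set: 'rV[R]_d]
      (fun v => Vfun g alpha eta (idx r) v (z r) (lambda r (idx r)))
      (x r.+1 (idx r));
  ng_lambda_pick : forall r, (1 <= r)%N ->
    lambda r.+1 (idx r) =
      lambda r (idx r) + (alpha (idx r) * eta (idx r)) *:
                         (x r.+1 (idx r) - z r);
  ng_lambda_other : forall r j, (1 <= r)%N -> j != idx r ->
    lambda r.+1 j = lambda r j;
  ng_x_other : forall r j, (1 <= r)%N -> j != idx r -> x r.+1 j = z r;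
  ng_z : forall r, (1 <= r)%N ->
    argmin Z (fun v => augL Z g g0 p eta (x r.+1) v (lambda r)) (z r.+1);
  ng_y_pick : forall r, (1 <= r)%N -> y r (idx r) = z r;
  ng_y_other : forall r j, (1 <= r)%N -> j != idx r -> y r j = y r.-1 j
}.

(* Main.v *)
(** Up to a constant, the sum of the quadratic terms of the augmented Lagrangian
    is [S / 2 * |z - u|^2], where [S] is the sum of the [eta i] and [u] is the
    average of [x_i + lambda_i / eta i] with weights [eta i / S].  The invariant
    [lambda_i^r = - grad g_i (y_i^(r-1)) / N] and the explicit minimizer of [V_i]
    turn this [u] into the stated one.  The subproblem has a single solution
    because [S] exceeds the possible nonconvexity of [g0]: the value at the
    midpoint of two distinct minimizers would be smaller. *)

Require Import Defs.
From HB Require Import structures.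
From mathcomp Require Import all_boot all_order all_algebra.
From mathcomp Require Import all_classical all_reals all_analysis.
From mathcomp Require Import ring lra.

Import Order.TTheory GRing.Theory Num.Theory.
Import numFieldNormedType.Exports.

Local Open Scope classical_set_scope.
Local Open Scope ring_scope.

(** * The Euclidean inner product and norm *)

Section DotProduct.
Context {R : realType} {d : nat}.
Implicit Types (u v w : 'rV[R]_d) (k : R).

Lemma dotpC u v : dotp u v = dotp v u.
Proof. by apply: eq_bigr => j _; rewrite mulrC. Qed.

Lemma dotpDl u v w : dotp (u + v) w = dotp u w + dotp v w.
Proof. by rewrite -big_split; apply: eq_bigr => j _; rewrite mxE mulrDl. Qed.

Lemma dotpZl k u v : dotp (k *: u) v = k * dotp u v.
Proof. by rewrite mulr_sumr; apply: eq_bigr => j _; rewrite mxE mulrA. Qed.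

Lemma dotpDr u v w : dotp u (v + w) = dotp u v + dotp u w.
Proof. by rewrite dotpC dotpDl !(dotpC _ u). Qed.

Lemma dotpZr k u v : dotp u (k *: v) = k * dotp u v.
Proof. by rewrite dotpC dotpZl dotpC. Qed.

Lemma dotpNl u v : dotp (- u) v = - dotp u v.
Proof. by rewrite -scaleN1r dotpZl mulN1r. Qed.

Lemma dotpNr u v : dotp u (- v) = - dotp u v.
Proof. by rewrite dotpC dotpNl dotpC. Qed.

Definition dotpE := (dotpDl, dotpDr, dotpNl, dotpNr, dotpZl, dotpZr).

Lemma dotp_suml (I : finType) (F : I -> 'rV[R]_d) v :
  dotp (\sum_i F i) v = \sum_i dotp (F i) v.
Proof.
rewrite exchange_big; apply: eq_bigr => j _.
by rewrite summxE mulr_suml.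
Qed.

Lemma dotp_ge0 u : 0 <= dotp u u.
Proof. by apply: sumr_ge0 => j _; rewrite -expr2 sqr_ge0. Qed.

Lemma dotp_eq0 u : dotp u u = 0 -> u = 0.
Proof.
move=> /eqP; rewrite psumr_eq0 => [/allP u0|j _]; last by rewrite -expr2 sqr_ge0.
apply/rowP => j; have := u0 j; rewrite mem_index_enum => /(_ isT).
by rewrite mulf_eq0 orbb mxE => /eqP.
Qed.

Lemma enorm_sqr u : enorm u ^+ 2 = dotp u u.
Proof. by rewrite sqr_sqrtr// dotp_ge0. Qed.

Lemma enorm_ge0 u : 0 <= enorm u.
Proof. exact: sqrtr_ge0. Qed.

Lemma enorm_gt0 u : u != 0 -> 0 < enorm u.
Proof.
rewrite lt0r enorm_ge0 andbT; apply: contra => /eqP u0.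
by apply/eqP/dotp_eq0; rewrite -enorm_sqr u0 expr0n.
Qed.

Lemma enormZ k u : enorm (k *: u) = `|k| * enorm u.
Proof.
by rewrite /enorm dotpZl dotpZr mulrA -expr2 sqrtrM ?sqr_ge0// sqrtr_sqr.
Qed.

(** Cauchy-Schwarz: for nonzero vectors, expand the nonnegative squared norm of
    [enorm v *: u - enorm u *: v] and divide by [2 * enorm u * enorm v]. *)
Lemma dotp_le_enorm u v : dotp u v <= enorm u * enorm v.
Proof.
have [->|u0] := eqVneq u 0.
  by rewrite -(scale0r v) dotpZl enormZ normr0 !mul0r.
have [->|v0] := eqVneq v 0.
  by rewrite -(scale0r u) dotpZr enormZ normr0 !mul0r mulr0.
have := dotp_ge0 (enorm v *: u - enorm u *: v).
rewrite !dotpE (dotpC v u) -!enorm_sqr.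
have := mulr_gt0 (enorm_gt0 _ u0) (enorm_gt0 _ v0).
move: (enorm u) (enorm v) (dotp u v) => a b c ab0 h.
rewrite -subr_ge0 -(pmulr_rge0 _ ab0); nra.
Qed.

End DotProduct.

(** * Gradients, the mean value theorem and second differences *)

Section Gradient.
Context {R : realType} {d : nat}.
Implicit Types (f : 'rV[R]_d -> R) (a m v x : 'rV[R]_d).

Lemma derive_grad f x v : differentiable f x -> 'D_v f x = dotp (grad f x) v.
Proof.
move=> df; rewrite deriveE// {1}(row_sum_delta v) linear_sum.
by apply: eq_bigr => j _; rewrite linearZ /= mxE deriveE// mulrC.
Qed.

Lemma is_derive_line f a v (t : R) : (forall x, differentiable f x) ->
  is_derive t 1 (fun s : R => f (a + s *: v)) (dotp (grad f (a + t *: v)) v).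
Proof.
move=> df.
have E : (fun h : R => h^-1 *: (((fun s : R => f (a + s *: v)) \o shift t) (h *: 1)
                            - f (a + t *: v)))
     = (fun h : R => h^-1 *: ((f \o shift (a + t *: v)) (h *: v) - f (a + t *: v))).
  apply/funext => h /=; congr (_ *: (f _ - _)).
  by rewrite [h *: 1]mulr1 scalerDl addrCA.
have D := @diff_derivable _ _ _ f (a + t *: v) v (df _).
split; first by rewrite /derivable E.
by rewrite /derive E -derive_grad.
Qed.

Lemma mean_value f a v : (forall x, differentiable f x) ->
  exists2 t : R, 0 <= t <= 1 & f (a + v) - f a = dotp (grad f (a + t *: v)) v.
Proof.
move=> df.
have [|||t] := @MVT_segment R (fun s : R => f (a + s *: v))
    (fun s => dotp (grad f (a + s *: v)) v) 0 1.
- exact: ler01.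
- by move=> t _; apply: is_derive_line.
- apply: derivable_within_continuous => t _.
  by have [] := is_derive_line f a v t df.
- rewrite in_itv /= scale1r scale0r addr0 subr0 mulr1 => t01 E.
  by exists t.
Qed.

(* The constant [2 * L] comes from the mean value theorem and is not sharp (the
   descent lemma gives [L]), but the assumption [3 * L0 < \sum_i eta i] leaves
   room for it. *)
Lemma lipschitz_grad_midpoint f (L : R) m v :
  (forall x, differentiable f x) -> lipschitz_grad f L ->
  2 * f m <= f (m - v) + f (m + v) + 2 * L * enorm v ^+ 2.
Proof.
move=> df fL.
have [->|v0] := eqVneq v 0.
  rewrite subr0 addr0 -(scale0r 0) enormZ normr0 mul0r; lra.
have vgt0 := enorm_gt0 _ v0.
have L0 : 0 <= L.
  by rewrite -(pmulr_lge0 _ vgt0) -[v]subr0 (le_trans _ (fL _ _))// enorm_ge0.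
(* The mean value theorem on each half of the segment turns the second difference of [f] into a
   difference of gradients at two points at most [2 * enorm v] apart. *)
have [t t01] := mean_value f (m - v) v df; rewrite subrK => E1.
have [s s01 E2] := mean_value f m v df.
have := dotp_le_enorm (grad f (m - v + t *: v) - grad f (m + s *: v)) v.
have := fL (m - v + t *: v) (m + s *: v).
have -> : m - v + t *: v - (m + s *: v) = (t - 1 - s) *: v.
  by apply/rowP => j; rewrite !mxE; ring.
rewrite enormZ dotpDl dotpNl -E1 -E2.
have : `|t - 1 - s| <= 2 by rewrite ler_norml; lra.
move: (`| _ |) (enorm (_ - _)) => k q k2 h1 h2.
have : q * enorm v <= L * (2 * enorm v) * enorm v.
  apply: ler_wpM2r; first exact: ltW.
  by apply: (le_trans h1); rewrite ler_wpM2l// ler_wpM2r// ltW.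
nra.
Qed.

End Gradient.

(** * Convexity at midpoints and uniqueness of minimizers *)

Section Convexity.
Context {R : realType} {d : nat}.
Implicit Types (a b m v : 'rV[R]_d).

Let half_ge0 : 0 <= 2^-1 :> R. Proof. by rewrite invr_ge0. Qed.

Let half_le1 : 2^-1 <= 1 :> R. Proof. by rewrite invf_le1 ?ler1n ?ltr0n. Qed.

Let half : {i01 R} := Itv01 half_ge0 half_le1.

Let conv_half a b :
  conv half (a : convex_lmodType 'rV[R]_d) b = 2^-1 *: (a + b).
Proof.
rewrite scalerDr; congr (_ *: _ + _ *: _); rewrite /= /unstable.onem; lra.
Qed.

Lemma convex_set_midpoint (Z : set 'rV[R]_d) a b :
  convex_set Z -> Z a -> Z b -> Z (2^-1 *: (a + b)).
Proof.
by move=> /(_ a b half) cZ Za Zb; rewrite -conv_half; apply/set_mem/cZ;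
  exact: mem_set.
Qed.

Lemma convex_function_midpoint (f : 'rV[R]_d -> R) m v :
  convex_function [set: 'rV[R]_d] f -> 2 * f m <= f (m - v) + f (m + v).
Proof.
move=> /(_ half (m - v) (m + v)); rewrite !in_setT => /(_ isT isT).
rewrite conv_half convRE /=.
have -> : 2^-1 *: (m - v + (m + v)) = m.
  by apply/rowP => j; rewrite !mxE; field.
rewrite /unstable.onem; lra.
Qed.

(* With [m] the midpoint of two minimizers, the squared distance [S/2 |v - u|^2]
   gains [S] times the squared half-distance, which beats the defect of [g0]. *)
Lemma argmin_unique (Z : set 'rV[R]_d) (g0 p : 'rV[R]_d -> R) (L0 S : R)
    (u a b : 'rV[R]_d) (F := fun v => p v + g0 v + S / 2 * enorm (v - u) ^+ 2) :
  convex_set Z -> convex_function [set: 'rV[R]_d] p ->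
  (forall x, differentiable g0 x) -> lipschitz_grad g0 L0 -> 0 < S ->
  (~ convex_function [set: 'rV[R]_d] g0 -> 3 * L0 < S) ->
  argmin Z F a -> argmin Z F b -> a = b.
Proof.
move=> cZ cp dg0 lg0 S0 hS [Za mina] [Zb minb].
pose m := 2^-1 *: (a + b); pose v := 2^-1 *: (b - a).
have Ea : a = m - v by apply/rowP => j; rewrite !mxE; field.
have Eb : b = m + v by apply/rowP => j; rewrite !mxE; field.
have Zm : Z m by apply: convex_set_midpoint.
clearbody m v.
have [v0|/enorm_gt0 v0] := eqVneq v 0; first by rewrite Ea Eb v0 subr0 addr0.
(* [C] bounds the midpoint defect of [g0] in both cases: [0] if [g0] is convex, [L0] otherwise. In
   the latter case [2 * L0 < S] follows from [3 * L0 < S] when [L0] is nonnegative and from [0 < S]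
   when it is negative. *)
have [C CS g0m] : exists2 C, 2 * C < S &
    2 * g0 m <= g0 (m - v) + g0 (m + v) + 2 * C * enorm v ^+ 2.
  have [cg0|/hS LS] := pselect (convex_function [set: 'rV[R]_d] g0).
    exists 0; first by rewrite mulr0.
    by rewrite mulr0 mul0r addr0; apply: convex_function_midpoint.
  exists L0; last exact: lipschitz_grad_midpoint.
  by have [] := lerP 0 L0; lra.
have pm := convex_function_midpoint p m v cp.
exfalso; have := mina _ Zm; have := minb _ Zm; rewrite /F Ea Eb.
have parallelogram : S / 2 * enorm (m - v - u) ^+ 2 + S / 2 * enorm (m + v - u) ^+ 2
    = S * enorm (m - u) ^+ 2 + S * enorm v ^+ 2.
  by rewrite !enorm_sqr !dotpE (dotpC v m) (dotpC u m) (dotpC u v); field.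
have : 2 * C * enorm v ^+ 2 < S * enorm v ^+ 2 by rewrite ltr_pM2r ?exprn_gt0.
move: parallelogram g0m pm; clear; lra.
Qed.

(** A point of [Z] has a finite value, which rules out minimizers outside [Z]. For empty [Z] the
    left side would be the whole space, since the function would be constantly [+oo]. *)
Lemma argmin_hfun (Z : set 'rV[R]_d) (p q : 'rV[R]_d -> R) :
  Z !=set0 ->
  argmin [set: 'rV[R]_d] (fun v => hfun Z p v + (q v)%:E)%E
  = argmin Z (fun v => p v + q v).
Proof.
move=> [z0 Zz0].
have hin v : Z v -> (hfun Z p v + (q v)%:E)%E = (p v + q v)%:E.
  by move=> Zv; rewrite /hfun /indicator mem_set// add0e EFinD.
have hout v : ~ Z v -> (hfun Z p v + (q v)%:E)%E = +oo%E.
  by move=> Zv; rewrite /hfun /indicator memNset.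
apply/seteqP; split=> a.
- move=> [_ mina]; have Za : Z a.
    apply: contrapT => Za; have := mina z0 I.
    by rewrite hout// hin// leye_eq.
  by split=> // b Zb; have := mina b I; rewrite !hin// lee_fin.
- move=> [Za mina]; split=> // b _.
  have [Zb|Zb] := pselect (Z b); last by rewrite (hout b Zb) leey.
  by rewrite !hin// lee_fin; apply: mina.
Qed.

End Convexity.

(** * Explicit quadratic minimization and completion of squares *)

Section Iteration.
Context {R : realType} {d N : nat}.

(** No derivative is taken: comparing [v] with the candidate [z - k^-1 *: w] gives [k / 2 * enorm (v
    - z + k^-1 *: w) ^+ 2 <= 0]. *)
Lemma quadratic_argmin (w z v : 'rV[R]_d) (c k : R) : 0 < k ->
  argmin [set: 'rV[R]_d]
    (fun x => c + dotp w (x - z) + k / 2 * enorm (x - z) ^+ 2) v ->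
  v - z = - (k^-1 *: w).
Proof.
move=> k0 [_ /(_ (z - k^-1 *: w) I)].
have -> : z - k^-1 *: w - z = - (k^-1 *: w) by rewrite addrC addKr.
rewrite !enorm_sqr => h; apply/eqP; rewrite -subr_eq0 opprK; apply/eqP/dotp_eq0.
apply/eqP; rewrite eq_le dotp_ge0 andbT.
rewrite -(pmulr_rle0 _ k0); move: (v - z) h => t.
rewrite !dotpE (dotpC t w).
have := mulVKf (lt0r_neq0 k0) (k^-1 * dotp w w).
have := mulVKf (lt0r_neq0 k0) (dotp w t).
lra.
Qed.

(** As a polynomial in [v], the sum has quadratic part [S / 2 * dotp v v] and linear part minus the
    product of [v] with the sum of the [lambda i + eta i *: x i]; the hypothesis on [u] matches the
    linear parts. *)
Lemma complete_square (c : 'I_N -> R) (lambda x : 'I_N -> 'rV[R]_d)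
    (eta : 'I_N -> R) (u : 'rV[R]_d) (S := \sum_(i < N) eta i) :
  S *: u = \sum_(i < N) (lambda i + eta i *: x i) ->
  exists K, forall v,
    \sum_(i < N) (c i + dotp (lambda i) (x i - v) + eta i / 2 * enorm (x i - v) ^+ 2)
    = S / 2 * enorm (v - u) ^+ 2 + K.
Proof.
move=> Su.
exists (\sum_(i < N) (c i + dotp (lambda i) (x i) + eta i / 2 * enorm (x i) ^+ 2)
        - S / 2 * enorm u ^+ 2) => v.
have -> : S / 2 * enorm (v - u) ^+ 2 =
    S / 2 * dotp v v - dotp (S *: u) v + S / 2 * enorm u ^+ 2.
  by rewrite !enorm_sqr !dotpE (dotpC v u); field.
rewrite [RHS](_ : _ = S / 2 * dotp v v - dotp (S *: u) v
    + \sum_(i < N) (c i + dotp (lambda i) (x i) + eta i / 2 * enorm (x i) ^+ 2));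
  last by ring.
rewrite Su dotp_suml /S !mulr_suml -sumrB -big_split; apply: eq_bigr => i _ /=.
by rewrite !enorm_sqr !dotpE (dotpC v (x i)); field.
Qed.

End Iteration.

(** * Invariants along one run of the algorithm *)

Section Run.
Context {R : realType} {d N : nat} (Z : set 'rV[R]_d)
  (g : 'I_N -> 'rV[R]_d -> R) (g0 p : 'rV[R]_d -> R) (alpha eta : 'I_N -> R)
  (z1 : 'rV[R]_d) (y0 : 'I_N -> 'rV[R]_d) (idx : nat -> 'I_N)
  (x lambda y : nat -> 'I_N -> 'rV[R]_d) (z : nat -> 'rV[R]_d).
Hypotheses (hrun : NESTT_G Z g g0 p alpha eta z1 y0 idx x lambda y z)
  (halpha : forall i, 0 < alpha i) (heta : forall i, 0 < eta i).

Lemma run_x_pick r : (1 <= r)%N ->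
  let i := idx r in
  x r.+1 i - z r =
    - ((alpha i * eta i)^-1 *: (N%:R^-1 *: grad (g i) (z r) + lambda r i)).
Proof.
move=> r1 i; have := ng_x_pick hrun r1.
rewrite -/i => h; apply: (@quadratic_argmin _ _ _ _ _ (N%:R^-1 * g i (z r))).
  exact: mulr_gt0.
move: h; congr (argmin _ _ _); apply/funext => v.
by rewrite /Vfun dotpDl dotpZl addrA.
Qed.

(** For the picked index, the explicit [x] step makes the dual update cancel the old multiplier and
    leave the scaled gradient at the new memory point; for the others, multiplier and memory point
    are both unchanged. *)
Lemma run_lambda r j : lambda r.+1 j = - (N%:R^-1 *: grad (g j) (y r j)).
Proof.
elim: r => [|r IH].
  by rewrite (ng_lambda1 hrun)
    (ng_y0 hrun).
have [->|ji] := eqVneq j (idx r.+1); last first.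
  by rewrite (ng_lambda_other hrun)//
    (ng_y_other hrun).
rewrite (ng_lambda_pick hrun)// run_x_pick//.
rewrite (ng_y_pick hrun)//.
rewrite scalerN scalerA divff ?mulf_neq0 ?gt_eqF// scale1r.
by rewrite opprD addrCA subrr addr0.
Qed.

Lemma run_center r (beta : R := (\sum_(i < N) eta i)^-1) : (1 <= r)%N ->
  \sum_(i < N) eta i != 0 ->
  let i := idx r in
  (\sum_(i < N) eta i) *:
    (z r - beta *:
        ((N%:R * alpha i)^-1 *: (grad (g i) (z r) - grad (g i) (y r.-1 i))
         + N%:R^-1 *: \sum_(j < N) grad (g j) (y r.-1 j)))
  = \sum_(j < N) (lambda r j + eta j *: x r.+1 j).
Proof.
(* The [z] step uses the old multipliers [lambda r], hence the memory points [y r.-1]; writing [r]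
   as a successor lets [run_lambda] apply. *)
case: r => [//|r] _ S0 i /=; rewrite scalerBr scalerA divff// scale1r.
rewrite scaler_suml scaler_sumr opprD addrCA -sumrB addrC.
rewrite (bigD1 i)//= [RHS](bigD1 i)//= addrAC; congr (_ + _); last first.
  apply: eq_bigr => j ji.
  by rewrite (ng_x_other hrun)// run_lambda addrC.
(* Only the picked term has [x] different from [z]; its displacement, multiplied by [eta i], yields
   the correction with factor [1 / (N * alpha i)]. *)
have /eqP := run_x_pick r.+1 isT; rewrite subr_eq => /eqP ->.
rewrite -/i run_lambda.
have a0 := gt_eqF (halpha i); have e0 := gt_eqF (heta i).
have N0 : N%:R != 0 :> R.
  by rewrite pnatr_eq0 -lt0n (leq_ltn_trans _ (ltn_ord i)).
by apply/rowP => j; rewrite !mxE; field; rewrite N0 a0 e0.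
Qed.

End Run.

Theorem proposition4p1 (R : realType) (d N : nat) (Z : set 'rV[R]_d)
    (g : 'I_N -> 'rV[R]_d -> R) (g0 p : 'rV[R]_d -> R)
    (Lg : 'I_N -> R) (L0 L : R) (alpha eta : 'I_N -> R)
    (disp : measure_display) (Omega : measurableType disp)
    (P : probability Omega R) (prob : 'I_N -> R) (idx : nat -> Omega -> 'I_N)
    (z1 : 'rV[R]_d) (y0 : 'I_N -> 'rV[R]_d)
    (x lambda y : nat -> Omega -> 'I_N -> 'rV[R]_d)
    (z : nat -> Omega -> 'rV[R]_d)
    (hN : (0 < N)%N)
    (hA : standing_assumptions Z g g0 p Lg L0 L eta)
    (halpha : forall i, 0 < alpha i)
    (hidx : index_sampling P prob idx)
    (hz1 : Z z1)
    (hrun : forall w, NESTT_G Z g g0 p alpha eta z1 y0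
      (fun r => idx r w) (fun r => x r w) (fun r => lambda r w)
      (fun r => y r w) (fun r => z r w)) :
  let beta : R := (\sum_(i < N) eta i)^-1 in
  forall (w : Omega) (r : nat), (1 <= r)%N ->
    let i := idx r w in
    let u : 'rV[R]_d :=
      z r w - beta *:
        ((N%:R * alpha i)^-1 *: (grad (g i) (z r w) - grad (g i) (y r.-1 w i))
         + N%:R^-1 *: \sum_(j < N) grad (g j) (y r.-1 w j)) in
    argmin [set: 'rV[R]_d]
      (fun v => (hfun Z p v + (g0 v)%:E
                 + ((2 * beta)^-1 * enorm (v - u) ^+ 2)%:E)%E)
    = [set z r.+1 w].
Proof.
move=> beta w r r1 i u.
have heta := sa_eta_gt0 hA.
pose S := \sum_(j < N) eta j.
have S0 : 0 < S.
  rewrite /S (bigD1 i)//= ltr_pwDl// sumr_ge0// => j _; exact: ltW.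
have [K HK] := complete_square (fun j => N%:R^-1 * g j (x r.+1 w j))
  (lambda r w) (x r.+1 w) eta u
  (run_center Z g g0 p alpha eta z1 y0 _ _ _ _ _ (hrun w) halpha heta r r1
    (lt0r_neq0 S0)).
pose F v := p v + g0 v + S / 2 * enorm (v - u) ^+ 2.
(* On [Z] the augmented Lagrangian differs from [F] only by the constant [K]. *)
have minz : argmin Z F (z r.+1 w).
  have [Zz minL] := ng_z (hrun w) r1.
  split=> // b Zb; have := minL b Zb.
  rewrite /augL !HK /hfun /indicator !mem_set// !add0e -!EFinD lee_fin /F -/S.
move: (S / 2 * _) (S / 2 * _) => e1 e2; lra.
have Z0 : Z !=set0 by exists (z r.+1 w); case: minz.
have -> : (fun v => (hfun Z p v + (g0 v)%:E
                 + ((2 * beta)^-1 * enorm (v - u) ^+ 2)%:E)%E)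
  = (fun v => hfun Z p v + (g0 v + S / 2 * enorm (v - u) ^+ 2)%:E)%E.
  by apply/funext => v; rewrite -addeA -EFinD invfM invrK [_^-1 * _]mulrC.
rewrite argmin_hfun//.
have -> : (fun v => p v + (g0 v + S / 2 * enorm (v - u) ^+ 2)) = F.
  by apply/funext => v; rewrite addrA.
(* Existence is [minz], so only uniqueness remains. *)
apply/seteqP; split=> [a mina|_ ->]//.
exact: (argmin_unique Z g0 p L0 S u _ _ (sa_Z_convex hA)
  (sa_p_convex hA) (sa_g0_diff hA)
  (sa_g0_lip hA) S0 (sa_eta_sum hA)).
Qed.
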